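(* Let $(X_A,\sigma_A)$ and $(X_B,\sigma_B)$ be one-sided topological Markov shifts (with $A$, $B$ as in the context). Then $(X_A,\sigma_A)$ and $(X_B,\sigma_B)$ are one-sided flow equivalent if and only if they are continuously orbit equivalent.
   Context: Let $N>1$ and let $A=[A(i,j)]_{i,j=1}^N$ be an irreducible matrix with entries in $\{0,1\}$ which is not a permutation matrix; likewise let $B$ be an $M\times M$ matrix ($M>1$) with the same properties. The one-sided topological Markov shift $(X_A,\sigma_A)$ consists of the compact space $X_A$ of all sequences $(x_n)_{n\in\mathbb N}$ with $x_n\in\{1,\dots,N\}$ and $A(x_n,x_{n+1})=1$ for all $n$ (product topology), with the shift map $\sigma_A((x_n)_{n\in\mathbb N})=(x_{n+1})_{n\in\mathbb N}$; similarly $(X_B,\sigma_B)$. $\mathbb Z_+$, $\mathbb R_+$ denote nonnegative integers and nonnegative reals. Cohomology: $H^A$ is the quotient of the group $C(X_A,\mathbb Z)$ of continuous integer-valued functions by the subgroup $\{g-g\circ\sigma_A : g\in C(X_A,\mathbb Z)\}$; $[f]$ denotes the class of $f$; $H^A_+=\{[f]: f\in C(X_A,\mathbb Z_+)\}$. An element $[f]\in H^A_+$ is an order unit if for every $[g]\in H^A$ there is $n\in\mathbb N$ with $n[f]-[g]\in H^A_+$. For a function $f$ on $X_A$ and $m\in\mathbb Z_+$, $f^m(x)=\sum_{i=0}^{m-1}f(\sigma_A^i(x))$. Same notions for $B$. Suspension triplet: a triple $(l,k,b)$ with $l,k\in C(X_A,\mathbb R_+)$, $b\in C(X_A,\mathbb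 R)$ such that (1) $c:=l-k$ is integer-valued and $[c]\in H^A_+$ is an order unit, and (2) $l-b$ and $k-b\circ\sigma_A$ take values in $\mathbb Z_+$. Let $X^{\mathbb R}_{A,b}=\{(x,r)\in X_A\times\mathbb R: r\ge b(x)\}$ and let $\sim_{l,k}$ be the equivalence relation on it generated by $(x,r)\sim_{l,k}(\sigma_A(x),r-c(x))$ whenever $r\ge l(x)$. The one-sided suspension $S^{l,k}_{A,b}$ is the quotient space $X^{\mathbb R}_{A,b}/\!\sim_{l,k}$, with $[x,r]$ the class of $(x,r)$, equipped with the flow $\phi_{A,t}([x,r])=[x,r+t]$, $t\in\mathbb R_+$, and base map $b_A:X_A\to S^{l,k}_{A,b}$, $b_A(x)=[x,b(x)]$. The standard suspension is $S^1_A:=S^{1,0}_{A,0}$ (triplet $(1,0,0)$) with standard base map $s_A(x)=[x,0]$. One-sided flow equivalence: $(X_A,\sigma_A)$ and $(X_B,\sigma_B)$ are one-sided flow equivalent if there exist suspension triplets $(l_1,k_1,b_1)$ for $(X_A,\sigma_A)$ and $(l_2,k_2,b_2)$ for $(X_B,\sigma_B)$, a homeomorphism $h:X_A\to X_B$ and continuous maps $\Phi_1:S^{l_1,k_1}_{A,b_1}\to S^1_B$, $\Phi_2:S^{l_2,k_2}_{B,b_2}\to S^1_A$ with $\Phi_1\circ\phi_{A,t}=\phi_{B,t}\circ\Phi_1$, $\Phi_2\circ\phi_{B,t}=\phi_{A,t}\circ\Phi_2$ for all $t\in\mathbb R_+$, $\Phi_1\circ b_{1,A}=s_B\circ h$ and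 $\Phi_2\circ b_{2,B}=s_A\circ h^{-1}$, where $b_{1,A}(x)=[x,b_1(x)]$ and $b_{2,B}(y)=[y,b_2(y)]$. Continuous orbit equivalence: there exist a homeomorphism $h:X_A\to X_B$ and continuous $k_1,l_1:X_A\to\mathbb Z_+$, $k_2,l_2:X_B\to\mathbb Z_+$ with $\sigma_B^{k_1(x)}(h(\sigma_A(x)))=\sigma_B^{l_1(x)}(h(x))$ for all $x\in X_A$ and $\sigma_A^{k_2(y)}(h^{-1}(\sigma_B(y)))=\sigma_A^{l_2(y)}(h^{-1}(y))$ for all $y\in X_B$. *)

(* Defs.v *)
From HB Require Import structures.
From mathcomp Require Import all_boot all_order all_algebra.
From mathcomp Require Import all_classical all_reals all_analysis.
From Stdlib Require Relation_Operators.
Set Implicit Arguments. Unset Strict Implicit. Unset Printing Implicit Defensive.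
Import Order.TTheory GRing.Theory Num.Theory.
Import numFieldTopology.Exports.
Local Open Scope classical_set_scope.
Local Open Scope ring_scope.
Local Open Scope quotient_scope.

Definition zero_one_mx (N : nat) (A : 'M[int]_N) : Prop :=
  forall i j, A i j = 0 \/ A i j = 1.

Definition mxpow (N : nat) (A : 'M[int]_N) (n : nat) : 'M[int]_N :=
  iter n (mulmx A) 1%:M.

Definition irreducible_mx (N : nat) (A : 'M[int]_N) : Prop :=
  forall i j, exists n : nat, 0 < mxpow A n.+1 i j.

(* Alphabet 'I_N = {0..N-1} (discrete), X_A is a subspace of the product    *)
(* space nat -> 'I_N, carried as the subtype [set_type] with the subspace    *)
(* (initial) topology.                                                       *)

Notation alph N := (discrete_topology 'I_N).

Definition XAset (N : nat) (A : 'M[int]_N) : set {ptws nat -> alph N} :=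
  [set x | forall n : nat, A (x n) (x n.+1) = 1].

Notation XA A := (set_type (XAset A)).

Lemma shift_XAset (N : nat) (A : 'M[int]_N) (x : {ptws nat -> alph N}) :
  x \in XAset A -> (fun n => x n.+1) \in XAset A.
Proof. by move=> /set_mem Hx; apply: mem_set => n; exact: Hx. Qed.

Definition sigmaA (N : nat) (A : 'M[int]_N) (x : XA A) : XA A :=
  exist _ (fun n => (sval x) n.+1) (shift_XAset (svalP x)).

(* Cohomology H^A = C(X_A,Z) / {g - g o sigma_A}, positive cone H^A_+,       *)
(* order units.  Z carries the discrete topology.                            *)

Definition Cint (N : nat) (A : 'M[int]_N) (f : XA A -> int) : Prop :=
  continuous (f : XA A -> discrete_topology int).

(* [f] \in H^A_+ : f is cohomologous to a continuous Z_+-valued function *)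
Definition cohom_pos (N : nat) (A : 'M[int]_N) (f : XA A -> int) : Prop :=
  exists (p g : XA A -> int), Cint p /\ Cint g /\ (forall x, 0 <= p x) /\
    forall x, f x - p x = g x - g (sigmaA x).

Definition order_unit (N : nat) (A : 'M[int]_N) (f : XA A -> int) : Prop :=
  Cint f /\ cohom_pos f /\
  forall g : XA A -> int, Cint g ->
    exists n : nat, cohom_pos (fun x => f x *+ n - g x).

Definition suspension_triplet (R : realType) (N : nat) (A : 'M[int]_N)
    (l k b : XA A -> R) : Prop :=
  continuous l /\ continuous k /\ continuous b /\
  (forall x, 0 <= l x) /\ (forall x, 0 <= k x) /\
  (exists c : XA A -> int, (forall x, l x - k x = (c x)%:~R) /\ order_unit c) /\
  (forall x, exists n : nat, l x - b x = n%:R) /\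
  (forall x, exists n : nat, k x - b (sigmaA x) = n%:R).

Section Suspension.
Context {R : realType} {N : nat} (A : 'M[int]_N) (l k b : XA A -> R).

Definition sdomset : set (XA A * R) := [set p | b p.1 <= p.2].
Local Notation sdom := (set_type sdomset).

Definition sstep (p q : sdom) : Prop :=
  l (sval p).1 <= (sval p).2 /\
  sval q = (sigmaA (sval p).1, (sval p).2 - (l (sval p).1 - k (sval p).1)).

Definition sequiv (p q : sdom) : bool := `[< Relation_Operators.clos_refl_sym_trans _ sstep p q >].

Lemma sequiv_refl : reflexive sequiv.
Proof. by move=> p; apply/asboolP; exact: Relation_Operators.rst_refl. Qed.

Lemma sequiv_sym : symmetric sequiv.
Proof.
by move=> p q; apply/asboolP/asboolP => H; apply: Relation_Operators.rst_sym.
Qed.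

Lemma sequiv_trans : transitive sequiv.
Proof.
move=> q p r /asboolP Hpq /asboolP Hqr; apply/asboolP; exact: Relation_Operators.rst_trans Hpq Hqr.
Qed.

Canonical sequiv_equiv :=
  EquivRelPack (EquivClass sequiv_refl sequiv_sym sequiv_trans).

Local Notation susp := (quotient_topology {eq_quot sequiv}).

Lemma sshift_mem (t : R) (p : sdom) :
  (((sval p).1, (sval p).2 + Num.max t 0) : XA A * R) \in sdomset.
Proof.
apply: mem_set; have /set_mem Hp := svalP p; rewrite /sdomset /= in Hp *.
by apply: (le_trans Hp); rewrite lerDl le_max lexx orbT.
Qed.

Definition sshift (t : R) (p : sdom) : sdom := exist (fun y : XA A * R => y \in sdomset) _ (sshift_mem t p).

(* the flow phi_t [x, r] = [x, r + t]   (used only for t >= 0) *)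
Definition sflow (t : R) (z : susp) : susp := \pi_susp (sshift t (repr z)).

Lemma sbase_mem (x : XA A) : ((x, b x) : XA A * R) \in sdomset.
Proof. by apply: mem_set; rewrite /sdomset /=. Qed.

Definition sbase (x : XA A) : susp := \pi_susp (exist (fun y : XA A * R => y \in sdomset) _ (sbase_mem x)).

End Suspension.

Notation sdom b := (set_type (sdomset b)).
Notation susp l k b := (quotient_topology {eq_quot (@sequiv _ _ _ l k b)}).

Notation susp1 R A :=
  (susp (fun _ : XA A => (1 : R)) (fun _ : XA A => (0 : R)) (fun _ : XA A => (0 : R))).
Definition sbase1 (R : realType) (N : nat) (A : 'M[int]_N) :=
  @sbase R N A (fun _ => (1 : R)) (fun _ => (0 : R)) (fun _ => (0 : R)).
Definition sflow1 (R : realType) (N : nat) (A : 'M[int]_N) :=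
  @sflow R N A (fun _ => (1 : R)) (fun _ => (0 : R)) (fun _ => (0 : R)).

Definition homeomorphism (X Y : topologicalType) (h : X -> Y) (hinv : Y -> X) :=
  continuous h /\ continuous hinv /\ cancel h hinv /\ cancel hinv h.

Definition one_sided_flow_equiv (R : realType) (N M : nat)
    (A : 'M[int]_N) (B : 'M[int]_M) : Prop :=
  exists (l1 k1 b1 : XA A -> R) (l2 k2 b2 : XA B -> R),
    suspension_triplet l1 k1 b1 /\ suspension_triplet l2 k2 b2 /\
    exists (h : XA A -> XA B) (hinv : XA B -> XA A)
           (Phi1 : susp l1 k1 b1 -> susp1 R B) (Phi2 : susp l2 k2 b2 -> susp1 R A),
      homeomorphism h hinv /\
      continuous Phi1 /\ continuous Phi2 /\
      (forall t z, 0 <= t -> Phi1 (@sflow R N A l1 k1 b1 t z) = @sflow1 R M B t (Phi1 z)) /\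
      (forall t z, 0 <= t -> Phi2 (@sflow R M B l2 k2 b2 t z) = @sflow1 R N A t (Phi2 z)) /\
      (forall x, Phi1 (@sbase R N A l1 k1 b1 x) = @sbase1 R M B (h x)) /\
      (forall y, Phi2 (@sbase R M B l2 k2 b2 y) = @sbase1 R N A (hinv y)).

Definition cont_orbit_equiv (N M : nat) (A : 'M[int]_N) (B : 'M[int]_M) : Prop :=
  exists (h : XA A -> XA B) (hinv : XA B -> XA A)
         (k1 l1 : XA A -> nat) (k2 l2 : XA B -> nat),
    homeomorphism h hinv /\
    continuous k1 /\ continuous l1 /\ continuous k2 /\ continuous l2 /\
    (forall x, iter (k1 x) (@sigmaA M B) (h (sigmaA x)) = iter (l1 x) (@sigmaA M B) (h x)) /\
    (forall y, iter (k2 y) (@sigmaA N A) (hinv (sigmaA y)) = iter (l2 y) (@sigmaA N A) (hinv y)).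

(* Main.v *)
(* A flow map sends the relation [x, l x] = [sigma x, k x] to
   [h x, l x - b x] = [h (sigma x), k x - b (sigma x)], an identity between
   integer heights in the standard suspension, where [y, n] = [sigma^n y, 0] and
   y |-> [y, 0] is injective; this is an orbit equivalence. Conversely, cocycles
   (k, l) of an orbit equivalence give the triplet (l, k, 0) and the flow map
   [x, r] |-> [h x, r]. The point is that l - k is an order unit. Its sum over a
   periodic orbit is positive because sigma^p expands near a p-periodic point,
   and a locally constant function with nonnegative periodic sums is cohomologous
   to a nonnegative one. *)
Require Import Defs.
From HB Require Import structures.
From mathcomp Require Import all_boot all_order all_algebra.
From mathcomp Require Import all_classical all_reals all_analysis.
From mathcomp Require Import perm zify.
From Stdlib Require Relation_Operators.
Import Order.TTheory GRing.Theory Num.Theory.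
Import numFieldTopology.Exports.
Local Open Scope classical_set_scope.
Local Open Scope ring_scope.

Set Implicit Arguments.
Unset Strict Implicit.
Unset Printing Implicit Defensive.

(** * Cylinders and compactness of the shift space *)

Section Topology.
Context {N : nat} (A : 'M[int]_N).

Definition agree (n : nat) (x y : XA A) : Prop :=
  forall i, (i < n)%N -> sval x i = sval y i.

Lemma agree_sym n x y : agree n x y -> agree n y x.
Proof. by move=> xy i ltin; rewrite xy. Qed.

Lemma agree_trans n x y z : agree n x y -> agree n y z -> agree n x z.
Proof. by move=> xy yz i ltin; rewrite xy ?yz. Qed.

Lemma agreeW m n x y : (m <= n)%N -> agree n x y -> agree m x y.
Proof. by move=> lemn xy i ltim; apply: xy; apply: leq_trans lemn. Qed.

Lemma eq_XA (x y : XA A) : sval x =1 sval y -> x = y.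
Proof.
case: x y => [x Hx] [y Hy] /= xy.
have {}xy : x = y by apply: functional_extensionality_dep.
by case: _ / xy Hy => Hy; congr exist; exact: bool_irrelevance.
Qed.

Lemma val_iter_sigmaA n (x : XA A) i : sval (iter n (@sigmaA N A) x) i = sval x (n + i)%N.
Proof. by elim: n i => //= n IHn i; rewrite IHn addnS. Qed.

Lemma agree_sigmaA n x y : agree n.+1 x y -> agree n (sigmaA x) (sigmaA y).
Proof. by move=> xy i ltin; apply: xy. Qed.

Lemma agree_iter_sigmaA m n x y : agree (m + n) x y ->
  agree n (iter m (@sigmaA N A) x) (iter m (@sigmaA N A) y).
Proof.
by move=> xy i ltin; rewrite !val_iter_sigmaA xy // ltn_add2l.
Qed.

Lemma nbhs_cylinder (x : {ptws nat -> alph N}) n :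
  nbhs x [set y | forall i, (i < n)%N -> x i = y i].
Proof.
have F : Filter (nbhs x) by exact: nbhs_filter.
elim: n => [|n IHn]; first exact: (@filterE _ _ F).
have ev : nbhs x [set y | y n = x n].
  have := @proj_continuous nat (fun=> alph N) n x [set x n].
  by apply; apply: discrete_set1.
apply: (@filterS _ _ F _ _ _ (@filterI _ _ F _ _ IHn ev)) => y /= [{}IHn {}ev] i.
by rewrite ltnS leq_eqVlt => /orP[/eqP ->//|/IHn].
Qed.

Lemma nbhs_agree (x : XA A) (U : set (XA A)) :
  nbhs x U <-> exists n, forall y, agree n x y -> U y.
Proof.
split=> [[_ [[/= B oB <-] Bx BU]]|[n nU]].
(* [F] is the filter of cylinders at [x]. It converges in each coordinate, hence in the product
   topology, so [B] contains a cylinder. *)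
- pose F := filter_from setT
    (fun n => [set w : {ptws nat -> alph N} | forall i, (i < n)%N -> sval x i = w i]).
  have FF : Filter F.
    apply: filter_from_filter; first by exists 0%N.
    move=> i j _ _; exists (maxn i j) => // w /= wij.
    by split=> k ltk; apply: wij; rewrite leq_max ltk ?orbT.
  have : F --> (sval x : {ptws nat -> alph N}).
    apply/cvg_sup => i C [_ [[D oD <-] Dx DC]].
    exists i.+1 => // w /(_ i (ltnSn i)) wx; apply: DC.
    by rewrite /= -wx.
  have nB : nbhs (sval x : {ptws nat -> alph N}) B by exact: open_nbhs_nbhs.
  case/(_ _ nB) => n _ nB'; exists n => y xy; apply: BU; exact: nB'.
- have := @initial_continuous (XA A) _ sval x _ (nbhs_cylinder (sval x) n).
  by move=> H; apply: (@filterS _ _ (nbhs_filter x) _ _ _ H) => y; exact: nU.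
Qed.

Lemma compact_XAset : compact (XAset A).
Proof.
have cT : compact [set: {ptws nat -> alph N}].
  have fT (n : nat) : finite_set [set: alph N] by exact: finite_finset.
  have := tychonoff (fun n => finite_compact (fT n)).
  by congr (compact _); rewrite eqEsubset.
apply: (subclosed_compact _ cT) => //.
move=> x clx n.
(* Admissibility at [n] involves only the letters [n] and [n.+1], which [x] shares with an
   admissible [y] in its cylinder of length [n.+2]. *)
have [y [Hy xy]] := clx _ (nbhs_cylinder x n.+2).
by rewrite !xy.
Qed.

(** Compactness turns thresholds valid on single cylinders into one threshold for all points. *)
Lemma XA_uniform (P : nat -> XA A -> Prop) :
  (forall x, exists n m, forall y, agree n x y -> forall i, (m <= i)%N -> P i y) ->
  exists m, forall x, P m x.
Proof.
move=> HP.
(* Compactness is known for a subset of the product, so [P] is carried over to ambient sequences,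
   vacuously outside [XAset A]. *)
pose Q i (w : {ptws nat -> alph N}) := forall y : XA A, sval y = w -> P i y.
have /compact_near_coveringP/(_ nat \oo Q _) := compact_XAset.
case.
- move=> w /mem_set Aw; have [n [m nm]] := HP (exist _ w Aw).
  exists ([set y | forall i, (i < n)%N -> w i = y i], [set i | (m <= i)%N]) => /=.
    by split; [exact: nbhs_cylinder|exists m].
  by case=> w' i [/= ww' mi] y yw'; apply: nm => // j ltj /=; rewrite ww' // yw'.
- move=> m _ /(_ m (leqnn m)) mQ; exists m => x.
  by apply: (mQ (sval x)) => //; apply: set_mem (svalP x).
Qed.

End Topology.

(** * Locally constant functions *)

Section LocallyConstant.
Context {N : nat} (A : 'M[int]_N).

(** [T] carries no topology, so that continuous maps to discrete [int] and to [nat] fall under one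
    notion. *)
Definition locally_constant (T : Type) (f : XA A -> T) : Prop :=
  forall x, exists n, forall y, agree n x y -> f x = f y.

Lemma locally_constant_continuous (T : topologicalType) (f : XA A -> T) :
  locally_constant f -> continuous f.
Proof.
move=> fC x U /nbhs_singleton Ux; have [n nf] := fC x.
by apply/nbhs_agree; exists n => y /nf; rewrite /= => <-.
Qed.

Lemma continuous_locally_constant (T : topologicalType) (f : XA A -> T) (x : XA A) :
  continuous f -> nbhs (f x) [set f x] -> exists n, forall y, agree n x y -> f x = f y.
Proof. by move=> cf /cf /nbhs_agree [n nf]; exists n => y /nf /= ->. Qed.

Lemma Cint_locally_constant (f : XA A -> int) : Cint f <-> locally_constant f.
Proof.
split=> [cf x|fC]; last exact: locally_constant_continuous.
by apply: (@continuous_locally_constant (discrete_topology int) f x cf); apply: discrete_set1.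
Qed.

Lemma continuous_nat_locally_constant (f : XA A -> nat) :
  continuous f <-> locally_constant f.
Proof.
split=> [cf x|fC]; last exact: locally_constant_continuous.
by apply: (@continuous_locally_constant nat f x cf); apply: discrete_set1.
Qed.

Lemma locally_constant_uniform T (f : XA A -> T) : locally_constant f ->
  exists n, forall x y, agree n x y -> f x = f y.
Proof.
move=> fC.
have [|n nP] := @XA_uniform _ A (fun n x => forall y, agree n x y -> f x = f y).
  move=> x; have [n nf] := fC x; exists n, n => y xy i leni z /(agreeW leni) yz.
  by rewrite -(nf y) // -(nf z) //; apply: agree_trans xy yz.
by exists n => x y; apply: nP.
Qed.

Lemma locally_constant_bounded (f : XA A -> int) : locally_constant f ->
  exists C : nat, forall x, `|f x| <= C%:Z.
Proof.
move=> fC; have [|C HC] := @XA_uniform _ A (fun n x => `|f x| <= n%:Z).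
  move=> x; have [n nf] := fC x; exists n, `|f x|%N => y /nf <- i.
  by lia.
by exists C.
Qed.

End LocallyConstant.

Section ContinuousAgree.
Context {N M : nat} (A : 'M[int]_N) (B : 'M[int]_M).

Lemma continuous_agree (h : XA A -> XA B) : continuous h ->
  forall x n, exists m, forall y, agree m x y -> agree n (h x) (h y).
Proof.
move=> ch x n; have : nbhs (h x) (agree n (h x)) by apply/nbhs_agree; exists n.
by move=> /ch /nbhs_agree.
Qed.

Lemma locally_constant_comp T (h : XA A -> XA B) (f : XA B -> T) : continuous h ->
  locally_constant f -> locally_constant (f \o h).
Proof.
move=> ch fC x; have [n nf] := fC (h x); have [m mh] := continuous_agree ch x n.
by exists m => y /mh /nf.
Qed.

Lemma locally_constant_op2 T1 T2 T3 (op : T1 -> T2 -> T3) f g :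
  locally_constant f -> locally_constant g ->
  @locally_constant _ A _ (fun x => op (f x) (g x)).
Proof.
move=> fC gC x; have [m mf] := fC x; have [n ng] := gC x.
exists (maxn m n) => y xy.
by congr op; [apply: mf|apply: ng]; apply: agreeW xy; rewrite ?leq_maxl ?leq_maxr.
Qed.

Lemma locally_constant_map T1 T2 (op : T1 -> T2) f :
  locally_constant f -> @locally_constant _ A _ (fun x => op (f x)).
Proof. by move=> fC x; have [n nf] := fC x; exists n => y /nf ->. Qed.

End ContinuousAgree.

Lemma continuous_sigmaA N (A : 'M[int]_N) : continuous (@sigmaA N A).
Proof.
move=> x U /nbhs_agree [n nU]; apply/nbhs_agree; exists n.+1 => y xy.
exact/nU/agree_sigmaA.
Qed.

(** * Admissible paths: splicing, closing and branching *)

Section Points.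
Context {N : nat} (A : 'M[int]_N).
Local Notation shift n := (iter n (@sigmaA N A)).

Lemma exists_point (u : nat -> 'I_N) : (forall n, A (u n) (u n.+1) = 1) ->
  exists x : XA A, forall n, sval x n = u n.
Proof. by move=> Au; exists (exist _ u (mem_set Au : u \in XAset A)). Qed.

Lemma val_XA (x : XA A) n : A (sval x n) (sval x n.+1) = 1.
Proof. exact: set_mem (svalP x) n. Qed.

Lemma splice (z y : XA A) n : sval z n = sval y 0%N ->
  exists2 w : XA A, shift n w = y & agree n.+1 w z.
Proof.
move=> zy.
pose u t := if (t < n)%N then sval z t else sval y (t - n)%N.
have un t : (t <= n)%N -> u t = sval z t.
  rewrite /u leq_eqVlt => /orP[/eqP ->|->//]; by rewrite ltnn subnn.
have [t|w wu] := @exists_point u.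
  have [ltn|len] := ltnP t n; first by rewrite !un ?val_XA // ltnW.
  rewrite /u ltnNge len ltnNge (leq_trans len (leqnSn t)) /=.
  by rewrite subSn // val_XA.
exists w; last by move=> i lti; rewrite wu un.
apply: eq_XA => i; rewrite val_iter_sigmaA wu /u.
by rewrite ltnNge leq_addr /= addKn.
Qed.

(** Repeat the first [p] letters of [z]. The agreement includes position [p] because [z] is back at
    its first letter there. *)
Lemma periodic_point (z : XA A) p : (0 < p)%N -> sval z p = sval z 0%N ->
  exists2 v : XA A, shift p v = v & agree p.+1 v z.
Proof.
move=> p0 zp.
have [t|v vu] := @exists_point (fun t => sval z (t %% p)%N).
  rewrite -addn1 -modnDml addn1.
  have := ltn_pmod t p0; rewrite leq_eqVlt => /orP[/eqP tp|tp].
    by rewrite tp modnn -zp -{2}tp val_XA.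
  by rewrite [in X in A _ (sval z X)]modn_small // val_XA.
exists v; first by apply: eq_XA => i; rewrite val_iter_sigmaA !vu modnDl.
move=> i; rewrite ltnS leq_eqVlt => /orP[/eqP ->|ip].
  by rewrite vu modnn zp.
by rewrite vu modn_small.
Qed.

Lemma val_periodic (x : XA A) p m i : shift p x = x -> sval x (m * p + i)%N = sval x i.
Proof.
by move=> px; elim: m => // m IHm; rewrite mulSn -addnA -val_iter_sigmaA px.
Qed.

Lemma mxpow_reach (A01 : zero_one_mx A) n i (y : XA A) :
  0 < mxpow A n i (sval y 0%N) -> exists2 z : XA A, sval z 0%N = i & shift n z = y.
Proof.
elim: n i => [|n IHn] i /=.
  by rewrite !mxE; case: eqP => // ->; exists y.
rewrite mxE => s0.
have [k] : exists k, 0 < A i k * mxpow A n k (sval y 0%N).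
  apply: contrapT => nk; have := s0; apply/negP; rewrite -leNgt.
  by apply: sumr_le0 => k _; rewrite leNgt; apply/negP => ?; apply: nk; exists k.
have [->|Aik] := A01 i k; first by rewrite mul0r ltxx.
rewrite Aik mul1r => /IHn [z zk zy].
have [t|w wu] := @exists_point (fun t => if t is t'.+1 then sval z t' else i).
  by case: t => [|t]; rewrite ?zk ?val_XA.
exists w; first by rewrite wu.
rewrite -zy; apply: eq_XA => t.
by rewrite -iterS !val_iter_sigmaA wu.
Qed.

(** By irreducibility a path leads from letter [q] of [z] back to letter 0, which closes the initial
    word up to a periodic point. The path depends only on the two letters, hence the bound [D]
    uniform in [z] and [q]. *)
Lemma closing (A01 : zero_one_mx A) (Airr : irreducible_mx A) :
  exists D, forall (z : XA A) q, exists v e,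
    [/\ (0 < e <= D)%N, shift (q + e)%N v = v & agree q v z].
Proof.
have /choice [d Hd] (ij : 'I_N * 'I_N) := Airr ij.1 ij.2.
exists (\max_ij (d ij).+1)%N => z q.
have [s sq sz] := mxpow_reach A01 (Hd (sval z q, sval z 0%N)).
have [w ws wz] := splice (esym sq).
set e := (d _).+1 in sz.
have [||v vp vw] := @periodic_point w (q + e)%N.
- by rewrite addnS.
- have -> : sval w (q + e)%N = sval (shift e (shift q w)) 0%N.
    by rewrite !val_iter_sigmaA addn0.
  by rewrite ws sz wz.
exists v, e; split=> //.
  exact: (leq_bigmax (sval z q, sval z 0%N)).
move=> i ltiq; rewrite vw ?wz //; first exact: ltnW.
by rewrite ltnS ltnW // (leq_trans ltiq) // leq_addr.
Qed.

Lemma exists_successor (A01 : zero_one_mx A) (Airr : irreducible_mx A) i :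
  exists j, A i j = 1.
Proof.
have [n] := Airr i i; rewrite /mxpow iterS mxE => s0.
apply: contrapT => nj; move: s0; rewrite big1 ?ltxx // => k _.
by have [->|Aik] := A01 i k; rewrite ?mul0r //; case: nj; exists k.
Qed.

(** With one successor per letter, [A] would be the matrix of a map [s]. Irreducibility makes [s]
    onto, hence bijective on the finite alphabet, and [A] a permutation matrix. *)
Lemma branching (A01 : zero_one_mx A) (Airr : irreducible_mx A) : ~ is_perm_mx A ->
  exists i j k, [/\ A i j = 1, A i k = 1 & j != k].
Proof.
move=> nperm; apply: contrapT => nobranch; apply: nperm.
have [s sA] := choice (exists_successor A01 Airr).
have Auniq i j : A i j = 1 -> j = s i.
  move=> Aij; apply/eqP/negP => /negP js; apply: nobranch.
  by exists i, j, (s i).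
have mxpow_orbit n i j : mxpow A n i j != 0 -> j = iter n s i.
  elim: n i => [|n IHn] i; first by rewrite !mxE; case: (eqVneq i j) => [->|_]; rewrite ?eqxx.
  rewrite /mxpow iterS mxE (bigD1 (s i)) //= big1 ?addr0 => [|k ks].
    by rewrite sA mul1r -iterS iterSr => /IHn.
  by have [->|/Auniq Aik] := A01 i k; rewrite ?mul0r //; rewrite Aik eqxx in ks.
have /choice [r rK] j : exists k, s k = j.
  have [n Ajj] := Airr j j.
  by exists (iter n s j); rewrite -iterS -(mxpow_orbit n.+1 j j) // gt_eqF.
have sinj : injective s := can_inj (canF_sym rK).
apply/existsP; exists (perm sinj); apply/eqP/matrixP => i j.
rewrite !mxE permE; case: eqP => [<-|sij]; first exact: sA.
by have [->|/Auniq /esym] := A01 i j.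
Qed.

Lemma exists_point_from (A01 : zero_one_mx A) (Airr : irreducible_mx A) i :
  exists x : XA A, sval x 0%N = i.
Proof.
have [s sA] := choice (exists_successor A01 Airr).
have [n|x xs] := @exists_point (fun n => iter n s i); first exact: sA.
by exists x; rewrite xs.
Qed.

Lemma not_isolated (A01 : zero_one_mx A) (Airr : irreducible_mx A) :
  ~ is_perm_mx A -> forall (x : XA A) n, exists2 y, agree n x y & y <> x.
Proof.
move=> nperm x n.
have [i [j [k [Aij Aik jk]]]] := branching A01 Airr nperm.
have [m Am] := Airr (sval x n) i.
(* The prefix of [x] is continued to the branching letter [i] and then in two ways. The results
   differ just after [i], so one of them is not [x]. *)
have through j' : A i j' = 1 ->
    exists2 y, agree n x y & sval y (n + m.+2)%N = j'.
  move=> Aij'; have [u u0] := exists_point_from A01 Airr j'.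
  have [t|u' uu'] := @exists_point (fun t => if t is t'.+1 then sval u t' else i).
    by case: t => [|t]; rewrite ?u0 ?val_XA.
  have [|w w0 wu'] := @mxpow_reach A01 m.+1 (sval x n) u'; first by rewrite uu'.
  have [y yw yx] := splice (esym w0).
  exists y; first by apply: agree_sym; apply: agreeW yx.
  have -> : sval y (n + m.+2)%N = sval (shift m.+1 (shift n y)) 1%N.
    by rewrite !val_iter_sigmaA addn1.
  by rewrite yw wu' uu'.
have [y xy yj] := through j Aij; have [z xz zk] := through k Aik.
have [yx|yx] := pselect (y = x); last by exists y.
by exists z => // zx; move: jk; rewrite -yj -zk yx zx eqxx.
Qed.

End Points.

(** * Birkhoff sums, periodic orbits and positivity in cohomology *)

Section Cohomology.
Context {N : nat} (A : 'M[int]_N).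
Local Notation shift n := (iter n (@sigmaA N A)).

Definition birkhoff (f : XA A -> int) (n : nat) (x : XA A) : int :=
  \sum_(i < n) f (shift i x).

Lemma birkhoffD f m n x :
  birkhoff f (m + n) x = birkhoff f m x + birkhoff f n (shift m x).
Proof.
rewrite /birkhoff big_split_ord /=; congr (_ + _).
by apply: eq_bigr => i _; rewrite addnC iterD.
Qed.

Lemma birkhoffB f g n x :
  birkhoff (fun y => f y - g y) n x = birkhoff f n x - birkhoff g n x.
Proof. exact: sumrB. Qed.

Lemma birkhoffMn f m n x : birkhoff (fun y => f y *+ m) n x = birkhoff f n x *+ m.
Proof. exact: sumrMnl. Qed.

Lemma birkhoff_coboundary g n x :
  birkhoff (fun y => g y - g (sigmaA y)) n x = g x - g (shift n x).
Proof.
rewrite /birkhoff; elim: n => [|n IHn]; first by rewrite big_ord0 subrr.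
by rewrite big_ord_recr IHn /= addrA subrK.
Qed.

Lemma birkhoff_bound f (C : nat) n x : (forall y, `|f y| <= C%:Z) ->
  `|birkhoff f n x| <= (n * C)%N%:Z.
Proof.
move=> fC; apply: (le_trans (ler_norm_sum _ _ _)).
apply: (le_trans (ler_sum _ (fun i _ => fC _))).
by rewrite sumr_const card_ord -mulr_natr; lia.
Qed.

Lemma birkhoff_agree f K n x y : (forall x y, agree K x y -> f x = f y) ->
  agree (n + K) x y -> birkhoff f n x = birkhoff f n y.
Proof.
move=> fK xy; apply: eq_bigr => i _; apply/fK/agree_iter_sigmaA.
by apply: agreeW xy; rewrite leq_add2r ltnW.
Qed.

Lemma birkhoff_periodic f p x m : shift p x = x ->
  birkhoff f (m * p) x = birkhoff f p x *+ m.
Proof.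
move=> px; elim: m => [|m IHm]; first by rewrite /birkhoff big_ord0.
by rewrite mulSn birkhoffD px IHm mulrS.
Qed.

(** A periodic orbit of length [n + K + e], with [e <= D], shadows the first [n + K] letters of [x],
    so the first [n] terms coincide. Its full sum is nonnegative, and the surplus [K + e] terms add
    at most [(K + D) * F]. *)
Lemma birkhoff_lower_bound (A01 : zero_one_mx A) (Airr : irreducible_mx A) f :
  locally_constant f ->
  (forall x p, (0 < p)%N -> shift p x = x -> 0 <= birkhoff f p x) ->
  exists C : nat, forall x n, - C%:Z <= birkhoff f n x.
Proof.
move=> fC fper; have [K fK] := locally_constant_uniform fC.
have [F fF] := locally_constant_bounded fC.
have [D clD] := closing A01 Airr.
exists ((K + D) * F)%N => x n.
have [v [e [/andP[e0 eD] vper vx]]] := clD x (n + K)%N.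
have := fper v _ _ vper; rewrite addn_gt0 e0 orbT => /(_ isT).
rewrite -addnA birkhoffD (birkhoff_agree fK vx) => ge0.
have := birkhoff_bound (K + e) (shift n v) fF.
have : (((K + e) * F)%N <= (K + D) * F)%N by rewrite leq_mul2r leq_add2l eD orbT.
by lia.
Qed.

Lemma int_min (S : int -> Prop) (C : nat) : S 0 -> (forall s, S s -> - C%:Z <= s) ->
  exists s, S s /\ forall t, S t -> s <= t.
Proof.
move=> S0 SC.
have exn : exists n : nat, `[< S (n%:Z - C%:Z) >].
  by exists C; apply/asboolP; rewrite subrr.
case: (ex_minnP exn) => m /asboolP Sm mmin; exists (m%:Z - C%:Z); split=> // t St.
have Ct := SC _ St; have := mmin `|(t + C%:Z)%R|%N.
have -> : `|(t + C%:Z)%R|%N%:Z - C%:Z = t by lia.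
by move=> /(_ (introT (asboolP _) St)); lia.
Qed.

(* The transfer function is [u x = min f^n z] over all [z] with [sigma^n z = x];
   looking into the past makes it depend on finitely many coordinates of [x]. *)
Lemma cohom_pos_of_periodic (A01 : zero_one_mx A) (Airr : irreducible_mx A) f :
  Cint f ->
  (forall x p, (0 < p)%N -> shift p x = x -> 0 <= birkhoff f p x) -> cohom_pos f.
Proof.
move=> /Cint_locally_constant fC fper.
have [C fl] := birkhoff_lower_bound A01 Airr fC fper.
have [K fK] := locally_constant_uniform fC.
pose S x s := exists n z, shift n z = x /\ s = birkhoff f n z.
have /choice [u uP] x : exists s, S x s /\ forall t, S x t -> s <= t.
  apply: (@int_min _ C) => [|_ [n [z [_ ->]]]]; last exact: fl.
  by exists 0%N, x; rewrite /birkhoff big_ord0.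
(* The tail of [z] from position [n] on can be replaced by [y], as the sum reads only [n + K]
   letters. Agreement on [K.+1] letters includes the splicing letter even if [K] is 0. *)
have Sagree x y : agree K.+1 x y -> forall s, S x s -> S y s.
  move=> xy _ [n [z [zx ->]]].
  have [|w wy wz] := @splice _ _ z y n.
    by rewrite -[n]addn0 -val_iter_sigmaA zx xy.
  exists n, w; split=> //; apply: (birkhoff_agree fK) => i lti.
  have [ltin|leni] := ltnP i n; first by rewrite wz // ltnW.
  rewrite -(subnKC leni) -!val_iter_sigmaA zx wy xy //.
  by rewrite ltnS leq_subLR ltnW.
have uC : locally_constant u.
  move=> x; exists K.+1 => y xy; have [Sx xmin] := uP x; have [Sy ymin] := uP y.
  apply/eqP; rewrite eq_le xmin ?ymin //; first exact: Sagree xy _ Sx.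
  exact: Sagree (agree_sym xy) _ Sy.
exists (fun x => f x + u x - u (sigmaA x)), (fun x => - u x); split; [|split; [|split]].
- apply/Cint_locally_constant/locally_constant_op2; first exact: locally_constant_op2.
  apply: locally_constant_map.
  exact: locally_constant_comp (@continuous_sigmaA _ _) uC.
- exact/Cint_locally_constant/locally_constant_map.
(* A path [z] attaining [u x] runs on to [sigmaA x] with sum [u x + f x], which is at least the
   minimum [u (sigmaA x)]. *)
- move=> x; have [[n [z [zx uz]]] _] := uP x; have [_ umin] := uP (sigmaA x).
  rewrite subr_ge0; apply: umin; exists n.+1, z; rewrite iterS zx; split=> //.
  by rewrite -addn1 birkhoffD -uz zx addrC /birkhoff big_ord1.
- by move=> x; lia.
Qed.

(** By the pigeonhole principle a long orbit segment repeats a block. The stretch between two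
    occurrences closes up to a periodic orbit and contributes at least 1; all other terms are
    nonnegative. *)
Lemma birkhoff_eventually_pos f :
  locally_constant f -> (forall x, 0 <= f x) ->
  (forall x p, (0 < p)%N -> shift p x = x -> 1 <= birkhoff f p x) ->
  exists L, forall x, 1 <= birkhoff f L x.
Proof.
move=> fC f0 fper; have [K fK] := locally_constant_uniform fC.
(* One more position than there are blocks. The length [K.+1] makes equal blocks share a letter even
   if [K] is 0, as closing up requires. *)
exists #|{ffun 'I_K.+1 -> 'I_N}|.+1 => x.
set L := _.+1.
pose block (i : 'I_L) : {ffun 'I_K.+1 -> 'I_N} := [ffun t : 'I_K.+1 => sval x (i + t)%N].
have [i [j [ij bij]]] : exists i j : 'I_L, (i < j)%N /\ block i = block j.
  have : ~ injective block by move=> /leq_card; rewrite card_ord ltnn.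
  move=> /existsNP [i /existsNP [j /not_implyP [bij ij]]].
  have [ltij|ltji|/val_inj//] := ltngtP i j; first by exists i, j.
  by exists j, i.
pose y := shift i x; pose p := (j - i)%N; have p0 : (0 < p)%N by rewrite subn_gt0.
have yp t : (t <= K)%N -> sval y (p + t)%N = sval y t.
  rewrite -ltnS => ltK; rewrite !val_iter_sigmaA addnA subnKC ?(ltnW ij) //.
  by have := congr1 (fun b : {ffun _} => b (Ordinal ltK)) bij; rewrite !ffunE.
have [|v vp vy] := @periodic_point _ _ y p p0; first by rewrite -(yp 0%N) ?addn0.
(* Equal sums require [K] letters beyond the period. Both points repeat with period [p] on this
   range, so agreement on the first period propagates. *)
have {}vy : agree (p + K) v y.
  move=> t; have [n] := ubnP t; elim: n t => // n IHn t ltn ltpK.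
  have [ltp|lep] := ltnP t p; first by rewrite vy // ltnW.
  rewrite -(subnKC lep) yp; last by lia.
  rewrite -val_iter_sigmaA vp; apply: IHn; lia.
have birk0 n z : 0 <= birkhoff f n z by apply: sumr_ge0.
have iL : (i + p <= L)%N by rewrite subnKC ltnW.
rewrite -(subnKC iL) !birkhoffD -/y -(birkhoff_agree fK vy).
by have := fper v p p0 vp; have := birk0 i x; have := birk0 (L - (i + p))%N (shift (i + p) x); lia.
Qed.

(** [f] is cohomologous to some [q >= 0] with the same periodic sums, whose sums over some fixed
    length [L] are all at least 1. A large multiple of [f] then dominates [g] on periodic orbits. *)
Lemma order_unit_of_periodic (A01 : zero_one_mx A) (Airr : irreducible_mx A) f :
  Cint f ->
  (forall x p, (0 < p)%N -> shift p x = x -> 1 <= birkhoff f p x) -> order_unit f.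
Proof.
move=> fC fper; have fpos : cohom_pos f.
  by apply: cohom_pos_of_periodic => // x p p0 /fper; move=> /(_ p0); lia.
split=> //; split=> // g gC.
have [q [h [qC [hC [q0 fq]]]]] := fpos.
have birk_fq x p : shift p x = x -> birkhoff f p x = birkhoff q p x.
  move=> px; apply/eqP; rewrite -subr_eq0 -birkhoffB.
  have -> : birkhoff (fun y => f y - q y) p x =
            birkhoff (fun y => h y - h (sigmaA y)) p x by apply: eq_bigr.
  by rewrite birkhoff_coboundary px subrr.
have [||L HL] := @birkhoff_eventually_pos q _ q0.
- exact/Cint_locally_constant.
- by move=> x p p0 px; rewrite -birk_fq ?fper.
have [G HG] := locally_constant_bounded (iffLR (Cint_locally_constant g) gC).
have HLm m x : m%:Z <= birkhoff q (m * L) x.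
  elim: m x => [|m IHm] x; first by rewrite /birkhoff big_ord0.
  by rewrite mulSn birkhoffD; have := HL x; have := IHm (shift L x); lia.
(* At a [p]-periodic point, [L * G] times the sum of [q] is [G] times its sum over [p * L] steps, so
   at least [p * G], which bounds the sum of [g]. *)
exists (L * G)%N; apply: cohom_pos_of_periodic => //.
  apply/Cint_locally_constant/locally_constant_op2; last exact/locally_constant_map/Cint_locally_constant.
  apply: (@locally_constant_map _ _ _ _ (fun a => a *+ (L * G))).
  exact/Cint_locally_constant.
move=> x p p0 px; rewrite birkhoffB birkhoffMn birk_fq // mulrnA subr_ge0.
rewrite -birkhoff_periodic // mulnC.
have := birkhoff_bound p x HG; have := HLm p x.
move: (birkhoff q _ x) (birkhoff g p x) => a b pa bG.
rewrite -mulr_natr; nia.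
Qed.

End Cohomology.

(** * The cocycle of an orbit equivalence on periodic orbits *)

Section OrbitEquivalence.
Context {N M : nat} (A : 'M[int]_N) (B : 'M[int]_M).
Context (h : XA A -> XA B) (hinv : XA B -> XA A) (k l : XA A -> nat).
Hypothesis hK : homeomorphism h hinv.
Hypothesis kC : continuous k.
Hypothesis lC : continuous l.
Hypothesis hkl : forall x,
  iter (k x) (@sigmaA M B) (h (sigmaA x)) = iter (l x) (@sigmaA M B) (h x).
Local Notation shift n := (iter n (@sigmaA N A)).

(** Kept in [nat] because these sums serve as numbers of shifts. *)
Definition birkhoff_nat (f : XA A -> nat) n x := (\sum_(i < n) f (shift i x))%N.

Lemma iter_orbit_cocycle n x :
  iter (birkhoff_nat k n x) (@sigmaA M B) (h (shift n x)) =
  iter (birkhoff_nat l n x) (@sigmaA M B) (h x).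
Proof.
rewrite /birkhoff_nat; elim: n => [|n IHn]; first by rewrite !big_ord0.
rewrite !big_ord_recr /= iterD hkl -iterD addnC iterD IHn.
by rewrite -iterD addnC.
Qed.

Lemma birkhoff_nat_locally_constant f n :
  locally_constant f -> locally_constant (birkhoff_nat f n).
Proof.
move=> fC; elim: n => [|n IHn] x.
  by exists 0%N => y _; rewrite /birkhoff_nat !big_ord0.
have [a aP] := IHn x; have [b bP] := fC (shift n x).
exists (maxn a (n + b)) => y xy; rewrite /birkhoff_nat !big_ord_recr /=.
congr addn; first by apply: aP; apply: agreeW xy; rewrite leq_maxl.
by apply/bP/agree_iter_sigmaA; apply: agreeW xy; rewrite leq_maxr.
Qed.

(* Near the periodic point [x], [sigma^p] expands. If the cocycle were [<= 0]
   then its conjugate by [h] would not expand near [h x], so that the whole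
   [sigma^p]-orbit of some [y <> x] would stay in a small cylinder around [x]. *)
Lemma orbit_cocycle_periodic_pos x p :
  (forall n, exists2 y, agree n x y & y <> x) ->
  (0 < p)%N -> shift p x = x -> (birkhoff_nat k p x < birkhoff_nat l p x)%N.
Proof.
move=> xlim p0 px; rewrite ltnNge; apply/negP.
have [hC [hinvC [hhK hinvK]]] := hK.
set a := birkhoff_nat l p x; set b := birkhoff_nat k p x => leab.
have [na naP] := birkhoff_nat_locally_constant p (iffLR (continuous_nat_locally_constant l) lC) x.
have [nb nbP] := birkhoff_nat_locally_constant p (iffLR (continuous_nat_locally_constant k) kC) x.
have [c cP] := continuous_agree hC x b.
(* On the cylinder of length [n] around [x] both cocycle sums are constant, a full period is
   visible, and [shift p] leaves [c] letters of agreement. *)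
pose n := (maxn (maxn na nb) (p + c))%N.
have [m0 m0P] := continuous_agree hinvC (h x) n.
pose m := maxn m0 b.
have close y : agree m (h x) (h y) -> agree n x y.
  move=> hxy; rewrite -(hhK x) -(hhK y); apply: m0P.
  by apply: agreeW hxy; rewrite leq_maxl.
have step y : agree m (h x) (h y) -> agree m (h x) (h (shift p y)).
  move=> hxy; have xy := close y hxy.
  have eqa : birkhoff_nat l p y = a.
    by apply/esym/naP; apply: agreeW xy; rewrite /n !leq_max leqnn.
  have eqb : birkhoff_nat k p y = b.
    by apply/esym/nbP; apply: agreeW xy; rewrite /n !leq_max leqnn !orbT.
  have hb : agree b (h x) (h (shift p y)).
    apply: cP; rewrite -[x in agree _ x]px; apply: agree_iter_sigmaA.
    by apply: agreeW xy; rewrite leq_maxr.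
  (* Below [b], continuity of [h] suffices. From [b] on, letter [i] of [h (shift p y)] is letter
     [i - b + a] of [h y], a position still below [m] because [a <= b]. *)
  move=> i ltim; have [/hb//|lebi] := ltnP i b.
  have ey := iter_orbit_cocycle p y; rewrite eqa eqb in ey.
  have ex := iter_orbit_cocycle p x; rewrite -/a -/b px in ex.
  rewrite -(subnKC lebi) -!val_iter_sigmaA ey ex !val_iter_sigmaA hxy //.
  by lia.
have [d dP] := continuous_agree hC x m.
have [y xy] := xlim d; apply; apply/esym/eq_XA => j.
have stay q : agree m (h x) (h (shift (q * p) y)).
  elim: q => [|q IHq]; first exact: dP.
  by rewrite mulSn iterD; exact: step.
have := close _ (stay (j %/ p)%N) (j %% p)%N.
rewrite val_iter_sigmaA -divn_eq => <-.
  by rewrite [in LHS](divn_eq j p) val_periodic.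
by apply: leq_trans (ltn_pmod j p0) _; rewrite /n leq_max leq_addr orbT.
Qed.

Lemma orbit_cocycle_order_unit :
  zero_one_mx A -> irreducible_mx A -> ~ is_perm_mx A ->
  order_unit (fun x => (l x)%:Z - (k x)%:Z).
Proof.
move=> A01 Airr nperm; apply: (order_unit_of_periodic A01 Airr) => [|x p p0 px].
  apply/Cint_locally_constant/locally_constant_op2.
    exact/locally_constant_map/continuous_nat_locally_constant.
  apply: (@locally_constant_map _ _ _ _ (fun n : nat => - n%:Z)).
  exact/continuous_nat_locally_constant.
have := orbit_cocycle_periodic_pos (not_isolated A01 Airr nperm x) p0 px.
suff -> : birkhoff (fun y => (l y)%:Z - (k y)%:Z) p x =
    (birkhoff_nat l p x)%:Z - (birkhoff_nat k p x)%:Z by lia.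
by rewrite birkhoffB /birkhoff /birkhoff_nat !(big_morph Posz PoszD (erefl 0)).
Qed.

End OrbitEquivalence.

(** * Classes and flow on a suspension *)

Section Suspension.
Local Open Scope quotient_scope.
Context {R : realType} {N : nat} (A : 'M[int]_N) (l k b : XA A -> R).
Local Notation rst := (Relation_Operators.clos_refl_sym_trans _ (@sstep R N A l k b)).

Definition susp_class (p : sdom b) : susp l k b := \pi_(susp l k b) p.

Lemma susp_classP p q : susp_class p = susp_class q <-> rst p q.
Proof.
split=> [pq|pq].
  by have /eqmodP/asboolP := pq.
by apply/eqmodP/asboolP.
Qed.

Lemma susp_class_repr z : susp_class (repr z) = z.
Proof. exact: reprK. Qed.

(** Raising both heights by the same nonnegative amount preserves a generating step. Hence the flow,
    defined through [repr], does not depend on the representative. *)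
Lemma susp_class_sshift t p q :
  susp_class p = susp_class q -> susp_class (sshift t p) = susp_class (sshift t q).
Proof.
rewrite !susp_classP; elim=> {p q} [p q [lp qE]|p|p q _ pq|p q r _ pq _ qr].
- apply: Relation_Operators.rst_step; split=> /=.
    by apply: le_trans lp _; rewrite lerDl le_max lexx orbT.
  by rewrite qE /= addrAC.
- exact: Relation_Operators.rst_refl.
- exact: Relation_Operators.rst_sym.
- exact: Relation_Operators.rst_trans pq qr.
Qed.

Lemma sflow_class t p : sflow t (susp_class p) = susp_class (sshift t p).
Proof. exact/susp_class_sshift/susp_class_repr. Qed.

End Suspension.

(** * The standard suspension and its base *)

Section StandardSuspension.
Context {R : realType} {N : nat} (A : 'M[int]_N).
Local Notation class1 := (@susp_class R N A (fun=> 1) (fun=> 0) (fun=> 0)).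
Local Notation sdom1 := (set_type (@sdomset R N A (fun=> 0))).

(** The lower bound on the height leaves at least 1 before each of the [n] generating steps. *)
Lemma class1_iter n (p q : sdom1) : n%:R <= (sval p).2 ->
  sval q = (iter n (@sigmaA N A) (sval p).1, (sval p).2 - n%:R) ->
  class1 p = class1 q.
Proof.
elim: n p q => [|n IHn] p q np qE.
  congr susp_class; apply: val_inj; rewrite /= qE subr0.
  by case: (sval p).
have r1 : 0 <= (sval p).2 - 1 by rewrite subr_ge0 (le_trans _ np) // ler1n.
pose p' : sdom1 := exist (fun y : XA A * R => y \in sdomset (fun=> 0))
  (sigmaA (sval p).1, (sval p).2 - 1) (mem_set r1).
transitivity (class1 p').
  apply/susp_classP; apply: Relation_Operators.rst_step; split => /=.
    by rewrite -subr_ge0.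
  by rewrite subr0.
apply: IHn => /=; first by rewrite lerBrDr natr1.
by rewrite qE iterSr -natr1 opprD addrA addrAC.
Qed.

Lemma sflow1_base n (y : XA A) : sflow1 n%:R (sbase1 R y) = sbase1 R (iter n (@sigmaA N A) y).
Proof.
rewrite /sflow1 /sbase1 /sbase -!/(susp_class _) sflow_class.
apply: (@class1_iter n) => /=; rewrite add0r max_l ?ler0n //.
by rewrite subrr.
Qed.

(* The integral part of the height determines how far the point must be shifted
   to reach height in [0, 1[; the resulting point is an invariant of the class. *)
Lemma sbase1_inj : injective (@sbase1 R N A).
Proof.
pose J z (p : sdom1) := exists n : nat,
  n%:R <= (sval p).2 < n.+1%:R /\ iter n (@sigmaA N A) (sval p).1 = z.
have J_inv z p q : class1 p = class1 q -> J z p <-> J z q.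
  move=> /susp_classP; elim=> {p q} [p q [/= p1 qE]|//|p q _ -> //|p q r _ -> _ -> //].
  rewrite /J qE /= subr0; split=> [[[|n] [/andP[np pn] pz]]|[n [/andP[np pn] pz]]].
  - by rewrite ltNge p1 in pn.
  - exists n; rewrite -iterSr lerBrDr natr1 np ltrBlDr natr1; split=> //.
  - by exists n.+1; rewrite iterSr -natr1 -lerBrDr np -natr1 -ltrBlDr.
move=> x y xy.
have : J x (exist (fun y : XA A * R => y \in sdomset (fun=> 0)) _ (sbase_mem (fun=> 0) x)).
  by exists 0%N; rewrite /= lexx ltr01.
move=> /(J_inv _ _ _ xy) [[|n] [/= /andP[n0 _] //]].
by move: n0; rewrite leNgt ltr0n.
Qed.

End StandardSuspension.

(** * Passing between flow maps and orbit maps *)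

Section FlowEquivalence.
Context {R : realType} {N M : nat} (A : 'M[int]_N) (B : 'M[int]_M).

Lemma continuous_of_natr (f : XA A -> nat) (g : XA A -> R) :
  continuous g -> (forall x, g x = (f x)%:R) -> continuous f.
Proof.
move=> gC gf; apply/continuous_nat_locally_constant => x.
(* Distinct natural numbers are at distance at least 1, so staying in the open unit ball forces
   equal values. *)
have := gC x _ (nbhsx_ballx (g x) 1 ltr01).
move=> /nbhs_agree [n nP]; exists n => y /nP.
rewrite /ball /= !gf !pmulrn -rmorphB -intr_norm ltrz1.
by lia.
Qed.

Lemma orbit_map_of_flow_map (l k b : XA A -> R) (h : XA A -> XA B)
    (Phi : susp l k b -> susp1 R B) :
  suspension_triplet l k b ->
  (forall t z, 0 <= t -> Phi (sflow t z) = sflow1 t (Phi z)) ->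
  (forall x, Phi (sbase l k b x) = sbase1 R (h x)) ->
  exists k' l' : XA A -> nat, [/\ continuous k', continuous l' &
    forall x, iter (k' x) (@sigmaA M B) (h (sigmaA x)) = iter (l' x) (@sigmaA M B) (h x)].
Proof.
move=> [lC [kC [bC [_ [_ [_ [/choice [l' lb] /choice [k' kb]]]]]]]] Phiflow Phibase.
exists k', l'; split.
- apply: (@continuous_of_natr k' (fun x => k x - b (sigmaA x))) => // x.
  apply: continuousB; first exact: kC.
  by apply: (@continuous_comp _ _ _ (@sigmaA N A) b x); [exact: continuous_sigmaA|exact: bC].
- apply: (@continuous_of_natr l' (fun x => l x - b x)) => // x.
  by apply: continuousB; [exact: lC|exact: bC].
- move=> x; apply: (@sbase1_inj R); rewrite -!sflow1_base -!Phibase -!Phiflow ?ler0n //.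
  (* From the base points over [sigmaA x] and [x], the times [k' x] and [l' x] lead to the heights
     [k x] and [l x], which one generating step relates. *)
  congr Phi; rewrite /sbase -!/(susp_class _) !sflow_class.
  apply/susp_classP; apply: Relation_Operators.rst_sym.
  apply: Relation_Operators.rst_step; split=> /=; rewrite !max_l ?ler0n // -?lb -?kb.
    by rewrite addrC subrK.
  by congr pair; rewrite ![b _ + _]addrC !subrK subKr.
Qed.

(** The map [(x, r) |-> (h x, r)] descends to classes: by the orbit identity, [(h x, r)] after [l x]
    steps and [(h (sigmaA x), r - l x + k x)] after [k x] steps reach the same point at height
    [r - l x]. *)
Lemma flow_map_of_orbit_map (k l : XA A -> nat) (h : XA A -> XA B) :
  continuous h ->
  (forall x, iter (k x) (@sigmaA M B) (h (sigmaA x)) = iter (l x) (@sigmaA M B) (h x)) ->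
  exists Phi : susp (fun x => (l x)%:R : R) (fun x => (k x)%:R) (fun=> 0) -> susp1 R B,
  [/\ continuous Phi, forall t z, 0 <= t -> Phi (sflow t z) = sflow1 t (Phi z) &
    forall x, Phi (sbase _ _ (fun=> 0) x) = sbase1 R (h x)].
Proof.
move=> hC hkl.
pose lR x : R := (l x)%:R; pose kR x : R := (k x)%:R.
pose class1 := @susp_class R M B (fun=> 1) (fun=> 0) (fun=> 0).
pose classA := @susp_class R N A lR kR (fun=> 0).
have memG (p : set_type (@sdomset R N A (fun=> 0))) :
    (h (sval p).1, (sval p).2) \in @sdomset R M B (fun=> 0).
  by apply: mem_set; have /set_mem := svalP p.
pose G p : set_type (@sdomset R M B (fun=> 0)) :=
  exist (fun y : XA B * R => y \in sdomset (fun=> 0)) _ (memG p).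
have Gclass p q : classA p = classA q -> class1 (G p) = class1 (G q).
  move=> /susp_classP; elim=> {p q} [p q [/= lp qE]|//|//|p q r _ -> _ ->//].
  have r0 : 0 <= (sval p).2 - lR (sval p).1 by rewrite subr_ge0.
  pose s : set_type (@sdomset R M B (fun=> 0)) :=
    exist (fun y : XA B * R => y \in sdomset (fun=> 0))
    (iter (l (sval p).1) (@sigmaA M B) (h (sval p).1), (sval p).2 - lR (sval p).1) (mem_set r0).
  transitivity (class1 s); first exact: (@class1_iter _ _ _ (l (sval p).1)).
  apply/esym/(@class1_iter _ _ _ (k (sval p).1)); rewrite /= qE /=.
    by rewrite opprB addrA addrAC lerDr.
  by rewrite hkl; congr pair; rewrite opprB addrA addrAC addrK.
exists (fun z => class1 (G (repr z))); split.
- have GC : continuous G.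
    apply: continuous_comp_initial => p.
    have valC := @initial_continuous (set_type (@sdomset R N A (fun=> 0))) _ sval p.
    have C1 := continuous_comp (continuous_comp valC cvg_fst) (hC _).
    have C2 := continuous_comp valC cvg_snd.
    exact: (@cvg_pair _ _ _ _ _ _ (nbhs_filter _) (nbhs_filter _) (nbhs_filter _) _ _ (C1 (nbhs_filter _)) (C2 (nbhs_filter _))).
  (* Continuity comes from the lift [class1 \o G], which is continuous and constant on classes,
     rather than from [repr]. *)
  apply: (@repr_comp_continuous _ _ _ (class1 \o G)).
    move=> p; apply: continuous_comp; [exact: GC|exact: pi_continuous].
  by move=> p q /eqP pq; apply/eqP/Gclass.
- move=> t z t0; rewrite -{1}(susp_class_repr z) sflow_class /sflow1 sflow_class.
  transitivity (class1 (G (sshift t (repr z)))); first exact/Gclass/susp_class_repr.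
  by congr class1; apply: val_inj.
- move=> x; transitivity (class1 (G (exist (fun y : XA A * R => y \in sdomset (fun=> 0)) _ (sbase_mem (fun=> 0) x)))).
    exact/Gclass/susp_class_repr.
  by congr class1; apply: val_inj.
Qed.

End FlowEquivalence.

Lemma orbit_cocycle_triplet (R : realType) N M (A : 'M[int]_N) (B : 'M[int]_M)
    (h : XA A -> XA B) (hinv : XA B -> XA A) (k l : XA A -> nat) :
  zero_one_mx A -> irreducible_mx A -> ~ is_perm_mx A ->
  homeomorphism h hinv -> continuous k -> continuous l ->
  (forall x, iter (k x) (@sigmaA M B) (h (sigmaA x)) = iter (l x) (@sigmaA M B) (h x)) ->
  suspension_triplet (fun x => (l x)%:R : R) (fun x => (k x)%:R) (fun=> 0).
Proof.
move=> A01 Airr nperm hK kC lC hkl.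
have natrC (f : XA A -> nat) : continuous f -> continuous (fun x => (f x)%:R : R).
  move=> fC; apply/locally_constant_continuous/locally_constant_map.
  exact/continuous_nat_locally_constant.
split; [exact: natrC|split; [exact: natrC|split; [exact: cst_continuous|]]].
split; [by move=> x; rewrite ler0n|split; [by move=> x; rewrite ler0n|]].
split; last by split=> x; [exists (l x)|exists (k x)]; rewrite subr0.
exists (fun x => (l x)%:Z - (k x)%:Z); split.
  by move=> x; rewrite intrB.
exact: orbit_cocycle_order_unit hK kC lC hkl A01 Airr nperm.
Qed.

Theorem theorem3p4 (R : realType) (N M : nat) (A : 'M[int]_N) (B : 'M[int]_M) :
  (1 < N)%N -> zero_one_mx A -> irreducible_mx A -> ~ is_perm_mx A ->
  (1 < M)%N -> zero_one_mx B -> irreducible_mx B -> ~ is_perm_mx B ->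
  (one_sided_flow_equiv R A B <-> cont_orbit_equiv A B).
Proof.
move=> _ A01 Airr Anperm _ B01 Birr Bnperm; split.
- move=> [l1 [k1 [b1 [l2 [k2 [b2 [tr1 [tr2]]]]]]]].
  move=> [h [hinv [Phi1 [Phi2 [hK [_ [_ [flow1 [flow2 [base1 base2]]]]]]]]]].
  have [m1 [n1 [m1C n1C mn1]]] := orbit_map_of_flow_map tr1 flow1 base1.
  have [m2 [n2 [m2C n2C mn2]]] := orbit_map_of_flow_map tr2 flow2 base2.
  by exists h, hinv, m1, n1, m2, n2.
- move=> [h [hinv [k1 [l1 [k2 [l2 [hK [k1C [l1C [k2C [l2C [kl1 kl2]]]]]]]]]]]].
  have hK' : homeomorphism hinv h by case: hK => [? [? [? ?]]].
  have [hC [hinvC _]] := hK.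
  have [Phi1 [Phi1C flow1 base1]] := @flow_map_of_orbit_map R _ _ _ _ _ _ _ hC kl1.
  have [Phi2 [Phi2C flow2 base2]] := @flow_map_of_orbit_map R _ _ _ _ _ _ _ hinvC kl2.
  do 6!eexists; split; first exact: orbit_cocycle_triplet A01 Airr Anperm hK k1C l1C kl1.
  split; first exact: orbit_cocycle_triplet B01 Birr Bnperm hK' k2C l2C kl2.
  by exists h, hinv, Phi1, Phi2.
Qed.
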